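(* Let $p$ be a prime and let $G$ be a $p$-group in the class $\mathfrak{C}$. Then the Nielsen graph $\Gamma_n(G)$ is connected for every $n\geq \operatorname{rank}(G)+1$.
   Context: $\mathfrak{C}$ is the class of finitely generated groups for which every maximal subgroup is normal. A $p$-group is a (possibly infinite) group in which every element has order a power of $p$. $\operatorname{rank}(G)$ is the minimal number of generators of $G$. For a finitely generated group $G$ and $n\ge \operatorname{rank}(G)$, the Nielsen graph $\Gamma_n(G)$ has as vertices the generating $n$-tuples $(g_1,\dots,g_n)\in G^n$, $\langle g_1,\dots,g_n\rangle=G$; two vertices are joined by an edge if one is obtained from the other by an elementary Nielsen move, i.e. by replacing $x_i$ by $x_ix_j^{\pm1}$ or by $x_j^{\pm1}x_i$ for some $j\ne i$, or by replacing $x_j$ by $x_j^{-1}$, the other entries being unchanged. *)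

(* Defs.v *)
From mathcomp Require Import all_boot.
From mathcomp Require Import boolp classical_sets.
From Stdlib Require Import Relation_Operators.

Set Implicit Arguments.
Unset Strict Implicit.
Unset Printing Implicit Defensive.

Local Open Scope classical_set_scope.
Local Open Scope group_scope.

(* [groupType] is the type of abstract, possibly infinite, groups; subgroups  *)
(* are arbitrary Prop-valued sets, with no decidability requirement.          *)

Definition is_subgroup (G : groupType) (H : set G) : Prop :=
  [/\ H 1, (forall x y, H x -> H y -> H (x * y)) & (forall x, H x -> H x^-1)].

Definition is_normal_subgroup (G : groupType) (N : set G) : Prop :=
  is_subgroup N /\ forall g x, N x -> N (x ^ g).

Definition is_maximal_subgroup (G : groupType) (M : set G) : Prop :=
  [/\ is_subgroup M, M <> setT &
      forall H : set G, is_subgroup H -> M `<=` H -> H = M \/ H = setT].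

Definition generated_subgroup (G : groupType) (S : set G) : set G :=
  smallest (@is_subgroup G) S.

Definition generating_tuple (G : groupType) (n : nat) (t : n.-tuple G) : Prop :=
  generated_subgroup [set x | x \in t] = setT.

Definition generated_by (G : groupType) (n : nat) : Prop :=
  exists t : n.-tuple G, generating_tuple t.

Definition finitely_generated (G : groupType) : Prop :=
  exists n : nat, generated_by G n.

(* The minimal number of generators of a finitely generated group (0 by       *)
(* convention when no finite generating tuple exists).                        *)
Definition group_rank (G : groupType) : nat :=
  xget 0 [set r : nat | generated_by G r /\
                        forall m : nat, generated_by G m -> (r <= m)%N].

Definition classC (G : groupType) : Prop :=
  finitely_generated G /\
  forall M : set G, is_maximal_subgroup M -> is_normal_subgroup M.

Definition has_order (G : groupType) (x : G) (m : nat) : Prop :=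
  [/\ (0 < m)%N, x ^+ m = 1 &
      forall k : nat, (0 < k)%N -> x ^+ k = 1 -> (m <= k)%N].

Definition p_group (p : nat) (G : groupType) : Prop :=
  forall x : G, exists k : nat, has_order x (p ^ k)%N.

Definition replace_entry (G : groupType) (n : nat) (t : n.-tuple G)
    (i : 'I_n) (y : G) : n.-tuple G :=
  [tuple if k == i then y else tnth t k | k < n].

Inductive nielsen_move (G : groupType) (n : nat) (t : n.-tuple G) :
    n.-tuple G -> Prop :=
| nielsen_mulr (i j : 'I_n) of j != i :
    nielsen_move t (replace_entry t i (tnth t i * tnth t j))
| nielsen_mulrV (i j : 'I_n) of j != i :
    nielsen_move t (replace_entry t i (tnth t i * (tnth t j)^-1))
| nielsen_mull (i j : 'I_n) of j != i :
    nielsen_move t (replace_entry t i (tnth t j * tnth t i))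
| nielsen_mulVl (i j : 'I_n) of j != i :
    nielsen_move t (replace_entry t i ((tnth t j)^-1 * tnth t i))
| nielsen_inv (j : 'I_n) :
    nielsen_move t (replace_entry t j (tnth t j)^-1).

Record graph : Type := Graph { vertex : Type; edge : vertex -> vertex -> Prop }.

Definition connected_graph (Gamma : graph) : Prop :=
  forall u v : vertex Gamma, clos_refl_trans _ (@edge Gamma) u v.

Definition nielsen_graph (G : groupType) (n : nat) : graph :=
  @Graph {t : n.-tuple G | generating_tuple t}
    (fun u v => nielsen_move (sval u) (sval v) \/
                nielsen_move (sval v) (sval u)).

(* Main.v *)
(* Every maximal subgroup M of G is normal of index p, hence the kernel of a   *)
(* homomorphism G -> F_p; as G is finitely generated, a tuple generates G iff  *)
(* no nonzero homomorphism G -> F_p vanishes on it. So generation is governed  *)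
(* by linear algebra over F_p and obeys the Steinitz exchange property.        *)
(* Fix a minimal generating tuple s. A generating tuple t longer than s has a  *)
(* redundant entry, and Nielsen moves can turn a redundant entry into any      *)
(* element of G. Put s_1 there: by exchange some other entry of t becomes      *)
(* redundant, put s_2 there, and so on. Once all of s is present every other   *)
(* entry can be made 1, so t is connected to (1, s, 1, ..., 1).                *)

Require Import Defs.
From mathcomp Require Import all_boot all_fingroup all_algebra.
From mathcomp Require Import zify.
From mathcomp Require Import boolp classical_sets.
From Stdlib Require Import Relation_Operators.

Set Implicit Arguments.
Unset Strict Implicit.
Unset Printing Implicit Defensive.

Import GRing.Theory.

Local Open Scope classical_set_scope.
Local Open Scope group_scope.

(** Two facts carry the argument. The first, [generatingP], detects generation by characters to
    ['F_p]: a proper subgroup lies in a maximal one ([proper_sub_maximal]), and normality together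
    with p-power torsion turns that maximal subgroup into the kernel of a character
    ([maximal_subgroup_char]). Linear algebra then yields [generating_exchange] and
    [generating_redundant]. The second, [nielsen_equiv_replace_head], makes a redundant entry
    arbitrary. [nielsen_equiv_exchange] alternates the two until a fixed minimal generating sequence
    is in place, so every longer generating tuple reaches a form depending only on its length. *)

Section Subgroups.
Variable G : groupType.
Implicit Types (H : set G) (s : seq G) (x y : G).

(** * Generated subgroups and maximal subgroups above proper ones *)

Lemma generated_is_subgroup (S : set G) : is_subgroup (generated_subgroup S).
Proof.
split=> [|x y Sx Sy|x Sx] H [sgH SH]; have [H1 HM HV] := sgH => //.
  by apply: HM; [apply: Sx | apply: Sy].
by apply: HV; apply: Sx.
Qed.

Lemma subgroupX H x k : is_subgroup H -> H x -> H (x ^+ k).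
Proof.
by case=> H1 HM _ Hx; elim: k => [|k IHk] //; rewrite expgS; apply: HM.
Qed.

Lemma subgroupMl H x y : is_subgroup H -> H x -> H (x * y) -> H y.
Proof. by case=> _ HM HV Hx Hxy; rewrite -(mulKg x y); apply: HM => //; exact: HV. Qed.

Definition seq_generated s : set G := generated_subgroup [set x | x \in s].
Definition generating s : Prop := seq_generated s = setT.

Lemma seq_generated_subgroup s : is_subgroup (seq_generated s).
Proof. exact: generated_is_subgroup. Qed.

Lemma mem_seq_generated s x : x \in s -> seq_generated s x.
Proof. by move=> sx; apply: sub_gen_smallest. Qed.

Lemma seq_generated_sub s H :
  is_subgroup H -> (forall x, x \in s -> H x) -> seq_generated s `<=` H.
Proof. by move=> sgH sH; apply: smallest_sub. Qed.

Lemma generating_trans s s' :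
  (forall x, x \in s -> seq_generated s' x) -> generating s -> generating s'.
Proof.
move=> ss' gs; rewrite /generating -subTset -gs.
exact: seq_generated_sub (seq_generated_subgroup s') ss'.
Qed.

Lemma generating_sub s s' : {subset s <= s'} -> generating s -> generating s'.
Proof.
by move=> ss'; apply: generating_trans => x /ss'; apply: mem_seq_generated.
Qed.

(* Enlarging H as long as it stays proper, one may assume that H and a single *)
(* element c generate G; the subgroups over H that avoid c are closed under   *)
(* unions of chains.                                                          *)
Lemma proper_sub_maximal H :
  finitely_generated G -> is_subgroup H -> H <> setT ->
  exists2 M : set G, is_maximal_subgroup M & H `<=` M.
Proof.
case=> n [t gt].
pose gen1 (K : set G) c := generated_subgroup (K `|` [set c]).
(* Induction on the list [s] of elements that, added to K, still generate G. *)
suff step s K : is_subgroup K -> K <> setT ->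
    (forall L, is_subgroup L -> K `<=` L -> (forall x, x \in s -> L x) -> L = setT) ->
    exists2 M : set G, is_maximal_subgroup M & K `<=` M.
  move=> sgH HnT; apply: (step t) => // L sgL _ tL.
  by rewrite -subTset -gt; apply: smallest_sub.
elim: s K => [|c s IHs] K sgK KnT KsT.
  by case: KnT; apply: KsT.
have KK1 : K `<=` gen1 K c.
  by move=> x Kx; apply: sub_gen_smallest; left.
have K1c : gen1 K c c by apply: sub_gen_smallest; right.
have [K1T|K1nT] := pselect (gen1 K c = setT); last first.
  have [|M maxM K1M] := IHs _ (generated_is_subgroup _) K1nT.
    move=> L sgL K1L sL; apply: KsT => //; first exact: subset_trans K1L.
    by move=> x; rewrite inE => /orP[/eqP->|/sL //]; apply: K1L.
  by exists M => //; apply: subset_trans K1M.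
(* Q is stated for K `|` L because it must also hold for the empty union. *)
pose Q (L : set G) := is_subgroup (K `|` L) /\ ~ (K `|` L) c.
have Kc : ~ K c.
  move=> Kc; apply: KnT; rewrite -subTset -K1T; apply: smallest_sub => //.
  by move=> x [//|->].
have [F FQ totF|M [[sgM Mc] maxM]] := @Zorn_bigcup G Q.
  split; last by case=> [//|[L /FQ[_ Lc] ?]]; apply: Lc; right.
  have [K1 KM KV] := sgK.
  split; first by left.
    move=> x y.
    have U L z : F L -> (K `|` L) z -> (K `|` \bigcup_(X in F) X) z.
      by move=> FL [Kz|Lz]; [left | right; exists L].
    move=> [Kx|[X FX Xx]] [Ky|[Y FY Yy]].
    - by left; apply: KM.
    - by apply: (U Y) => //; case: (FQ _ FY) => -[_ YM _] _; apply: YM; [left|right].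
    - by apply: (U X) => //; case: (FQ _ FX) => -[_ XM _] _; apply: XM; [right|left].
    - case: (totF _ _ FX FY) => [XY|YX].
        apply: (U Y) => //; case: (FQ _ FY) => -[_ YM _] _.
        by apply: YM; right => //; apply: XY.
      apply: (U X) => //; case: (FQ _ FX) => -[_ XM _] _.
      by apply: XM; right => //; apply: YX.
  move=> x [Kx|[X FX Xx]]; first by left; apply: KV.
  case: (FQ _ FX) => -[_ _ XV] _.
  by have [|?] := XV x (or_intror Xx); [left | right; exists X].
exists (K `|` M); last by move=> x; left.
split=> //; first by move=> MT; apply: Mc; rewrite MT.
(* A subgroup containing c is everything, since K and c generate; one avoiding c falls under the
   maximality given by Zorn. *)
move=> L sgL ML; have [Lc|nLc] := pselect (L c); [right|left].
  rewrite -subTset -K1T; apply: smallest_sub => // x [Kx|->] //.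
  by apply: ML; left.
have KL : K `|` L = L by apply/setUidPr => x Kx; apply: ML; left.
have [/seteqP LM|nLM] := pselect (M = L).
  by apply/seteqP; split => //; move=> x Lx; right; apply: LM.2.
case: (maxM L); last by split; rewrite KL.
split=> [x Mx|LM]; first by apply: ML; right.
by apply: nLM; apply/seteqP; split => // x Mx; apply: ML; right.
Qed.

End Subgroups.

(** * Nielsen moves on tuples and on sequences *)

Section Nielsen.
Variable G : groupType.

Definition nielsen_edge n (t u : n.-tuple G) : Prop :=
  nielsen_move t u \/ nielsen_move u t.
Definition nielsen_conn n := clos_refl_trans (n.-tuple G) (@nielsen_edge n).

Lemma nielsen_conn_sym n (t u : n.-tuple G) : nielsen_conn t u -> nielsen_conn u t.
Proof.
elim=> [x y xy|x|x y z _ yx _ zy].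
- by apply: rt_step; case: xy; [right|left].
- exact: rt_refl.
- exact: rt_trans zy yx.
Qed.

Lemma tnth_replace n (t : n.-tuple G) i y k :
  tnth (replace_entry t i y) k = if k == i then y else tnth t k.
Proof. exact: tnth_mktuple. Qed.

Lemma replace_replace n (t : n.-tuple G) i y z :
  replace_entry (replace_entry t i y) i z = replace_entry t i z.
Proof. by apply: eq_from_tnth => k; rewrite !tnth_replace; case: eqP. Qed.

Lemma replace_id n (t : n.-tuple G) i : replace_entry t i (tnth t i) = t.
Proof. by apply: eq_from_tnth => k; rewrite !tnth_replace; case: eqP => [->|]. Qed.

Lemma replace_entry_generated n (t : n.-tuple G) i y :
  seq_generated t y -> seq_generated (replace_entry t i y) (tnth t i) ->
  seq_generated t = seq_generated (replace_entry t i y).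
Proof.
move=> ty ui; apply/seteqP; split; apply: seq_generated_sub;
  try exact: seq_generated_subgroup; move=> _ /tnthP[k ->].
- have [->//|/negPf ki] := eqVneq k i; apply: mem_seq_generated.
  by apply/tnthP; exists k; rewrite tnth_replace ki.
- rewrite tnth_replace; case: ifP => // _.
  by apply: mem_seq_generated; apply: mem_tnth.
Qed.

Lemma nielsen_move_generated n (t u : n.-tuple G) :
  nielsen_move t u -> seq_generated t = seq_generated u.
Proof.
have [_ tM tV] := seq_generated_subgroup t.
have tk k : seq_generated t (tnth t k) by apply: mem_seq_generated; apply: mem_tnth.
have uy i y : seq_generated (replace_entry t i y) y.
  by apply: mem_seq_generated; apply/tnthP; exists i; rewrite tnth_replace eqxx.
have uj i j y : j != i -> seq_generated (replace_entry t i y) (tnth t j).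
  by move=> /negPf ji; apply: mem_seq_generated; apply/tnthP; exists j;
    rewrite tnth_replace ji.
case=> [i j ji|i j ji|i j ji|i j ji|i]; apply: replace_entry_generated; auto;
  set u' := replace_entry _ _ _; have [_ uM uV] := seq_generated_subgroup u'.
- by rewrite -(mulgK (tnth t j) (tnth t i)); apply: uM; [|apply: uV]; rewrite /u'; auto.
- by rewrite -(mulgVK (tnth t j) (tnth t i)); apply: uM; rewrite /u'; auto.
- by rewrite -(mulKg (tnth t j) (tnth t i)); apply: uM; [apply: uV|]; rewrite /u'; auto.
- by rewrite -(mulVKg (tnth t j) (tnth t i)); apply: uM; rewrite /u'; auto.
- by rewrite -(invgK (tnth t i)); apply: uV; rewrite /u'; auto.
Qed.

(** Moves preserve the generated subgroup, so a path of arbitrary tuples starting at a generating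
    one never leaves the graph. *)
Lemma nielsen_conn_connected n (u v : vertex (nielsen_graph G n)) :
  nielsen_conn (sval u) (sval v) -> clos_refl_trans _ (@edge (nielsen_graph G n)) u v.
Proof.
case: u v => [t gt] [t' gt'] /= c.
elim: c gt gt' => {t t'} [t t' tt'|t|t t' t'' tt' IH1 _ IH2] gt gt'.
- exact: rt_step.
- by rewrite (Prop_irrelevance gt gt'); apply: rt_refl.
have gm : generating_tuple t'.
  elim: tt' gt {IH1 IH2} => // [x y [xy|yx]|x y z _ IH1 _ IH2 gx].
  - by rewrite /generating_tuple -!/(seq_generated _) (nielsen_move_generated xy).
  - by rewrite /generating_tuple -!/(seq_generated _) (nielsen_move_generated yx).
  - exact/IH2/IH1.
exact: rt_trans (IH1 gt gm) (IH2 gm gt').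
Qed.

Lemma nielsen_conn_mulr n (t : n.-tuple G) i y :
  generated_subgroup [set x | exists2 j, j != i & x = tnth t j] y ->
  nielsen_conn t (replace_entry t i (tnth t i * y)).
Proof.
move=> gy.
(* H is a subgroup. Quantifying over all u that agree with t off i lets the product and inverse
   cases start from an already modified entry i. *)
pose H := [set y | forall u : n.-tuple G, (forall j, j != i -> tnth u j = tnth t j) ->
   nielsen_conn u (replace_entry u i (tnth u i * y))].
suff: H y by apply.
apply: gy; split.
  split=> [u _|x z Hx Hz u ut|x Hx u ut].
  - by rewrite mulg1 replace_id; apply: rt_refl.
  - apply: rt_trans (Hx u ut) _; set v := replace_entry _ _ _.
    have vt j : j != i -> tnth v j = tnth t j.
      by move=> ji; rewrite tnth_replace (negPf ji) ut.
    by have := Hz v vt; rewrite replace_replace tnth_replace eqxx mulgA.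
  - apply: nielsen_conn_sym; set v := replace_entry _ _ _.
    have vt j : j != i -> tnth v j = tnth t j.
      by move=> ji; rewrite tnth_replace (negPf ji) ut.
    by have := Hx v vt; rewrite replace_replace tnth_replace eqxx mulgVK replace_id.
move=> _ [j ji ->] u ut; rewrite -(ut j ji).
by apply: rt_step; left; apply: nielsen_mulr.
Qed.

Lemma nielsen_conn_swap n (t : n.-tuple G) i j :
  nielsen_conn t [tuple tnth t (tperm i j k) | k < n].
Proof.
have [<-|ij] := eqVneq i j.
  suff -> : [tuple tnth t (tperm i i k) | k < n] = t by apply: rt_refl.
  by apply: eq_from_tnth => k; rewrite tnth_mktuple tperm1 perm1.
(* (x, y) -> (xy, y) -> (xy, y^-1) -> (xy, x) -> (y, x) *)
have ji : j != i by rewrite eq_sym.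
set x := tnth t i; set y := tnth t j.
pose t1 := replace_entry t i (x * y).
pose t2 := replace_entry t1 j y^-1.
pose t3 := replace_entry t2 j x.
have conn1 u v : nielsen_move u v -> nielsen_conn u v.
  by move=> uv; apply: rt_step; left.
have c1 : nielsen_conn t t1 by apply/conn1/nielsen_mulr.
have t1j : tnth t1 j = y by rewrite tnth_replace (negPf ji).
have c2 : nielsen_conn t1 t2 by rewrite /t2 -t1j; apply/conn1/nielsen_inv.
have c3 : nielsen_conn t2 t3.
  have -> : t3 = replace_entry t2 j (tnth t2 i * tnth t2 j).
    by rewrite !tnth_replace !eqxx (negPf ij) mulgK.
  exact/conn1/nielsen_mull.
apply: rt_trans c1 _; apply: rt_trans c2 _; apply: rt_trans c3 _.
suff -> : [tuple tnth t (tperm i j k) | k < n] =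
          replace_entry t3 i ((tnth t3 j)^-1 * tnth t3 i) by apply/conn1/nielsen_mulVl.
apply: eq_from_tnth => k; rewrite tnth_mktuple !tnth_replace !eqxx (negPf ij) mulKg.
by case: tpermP => [->|->|/eqP/negPf-> /eqP/negPf->]; rewrite ?eqxx ?(negPf ji).
Qed.

Lemma nielsen_conn_permute n (t : n.-tuple G) (p : 'S_n) :
  nielsen_conn t [tuple tnth t (p k) | k < n].
Proof.
have [ts -> _] := prod_tpermP p; elim: ts t => [|[i j] ts IHts] t.
  rewrite big_nil; suff -> : [tuple tnth t ((1 : 'S_n) k) | k < n] = t by apply: rt_refl.
  by apply: eq_from_tnth => k; rewrite tnth_mktuple perm1.
rewrite big_cons /=; set q := \prod_(_ <- _) _.
suff -> : [tuple tnth t ((tperm i j * q) k) | k < n] =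
          [tuple tnth [tuple tnth t (q k) | k < n] (tperm i j k) | k < n].
  exact: rt_trans (IHts t) (nielsen_conn_swap _ i j).
by apply: eq_from_tnth => k; rewrite !tnth_mktuple permM.
Qed.

(** Stated on sequences so that concatenation and reordering need no casts between tuple lengths. *)
Definition nielsen_equiv (s s' : seq G) : Prop :=
  exists n (t t' : n.-tuple G), [/\ s = t, s' = t' & nielsen_conn t t'].

Lemma nielsen_equiv_sym s s' : nielsen_equiv s s' -> nielsen_equiv s' s.
Proof. by case=> n [t] [t'] [-> -> /nielsen_conn_sym c]; exists n, t', t. Qed.

Lemma nielsen_equiv_trans s1 s2 s3 :
  nielsen_equiv s1 s2 -> nielsen_equiv s2 s3 -> nielsen_equiv s1 s3.
Proof.
case=> n [t] [t'] [-> -> c] [m] [u] [u'] [t'u -> c'].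
have nm : n = m by rewrite -(size_tuple t') t'u size_tuple.
case: m / nm in u u' t'u c' *; exists n, t, u'; split=> //.
by rewrite (val_inj t'u) in c; apply: rt_trans c c'.
Qed.

Lemma nielsen_equiv_conn n (t t' : n.-tuple G) : nielsen_equiv t t' -> nielsen_conn t t'.
Proof.
case=> m [u] [u'] [tu t'u c].
have mn : m = n by rewrite -(size_tuple u) -tu size_tuple.
by case: n / mn in t t' tu t'u *; rewrite (val_inj tu) (val_inj t'u).
Qed.

Lemma nielsen_equiv_perm s s' : perm_eq s s' -> nielsen_equiv s s'.
Proof.
rewrite -[s']/(val (in_tuple s')) => /tuple_permP[p ->]; apply: nielsen_equiv_sym.
by exists (size s'), (in_tuple s'), [tuple tnth (in_tuple s') (p k) | k < size s'];
  split=> //; apply: nielsen_conn_permute.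
Qed.

(** As s alone generates, x^-1 y is a word in the other entries, and x can be multiplied by it. *)
Lemma nielsen_equiv_replace_head x y s :
  generating s -> nielsen_equiv (x :: s) (y :: s).
Proof.
move=> gs; have sT z : seq_generated s z by rewrite gs.
exists (size s).+1, [tuple of x :: in_tuple s], [tuple of y :: in_tuple s]; split=> //.
have -> : [tuple of y :: in_tuple s] = replace_entry [tuple of x :: in_tuple s] ord0
    (tnth [tuple of x :: in_tuple s] ord0 * (x^-1 * y)).
  apply: eq_from_tnth => k; rewrite tnth_replace tnth0 mulVKg.
  by case: (unliftP ord0 k) => [j|] ->; rewrite ?tnth0 // !tnthS.
apply: nielsen_conn_mulr; apply: seq_generated_sub (sT _); first exact: generated_is_subgroup.
move=> z /(tnthP (in_tuple s))[j ->]; apply: sub_gen_smallest.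
by exists (lift ord0 j); rewrite ?tnthS.
Qed.
End Nielsen.

(** * Maximal subgroups as kernels of characters to the prime field *)

Section Characters.
Variables (p : nat) (G : groupType).
Hypotheses (hp : prime p) (hG : p_group p G) (hC : classC G).
Implicit Types (u v w s : seq G) (x y : G) (M : set G).

Definition additive_char (chi : G -> 'F_p) := {morph chi : x y / x * y >-> (x + y)%R}.

Lemma additive_char1 chi : additive_char chi -> chi 1 = 0%R.
Proof. by move=> cM; apply: (addrI (chi 1)); rewrite -cM mulg1 addr0. Qed.

Lemma additive_char_subgroup chi :
  additive_char chi -> is_subgroup [set x | chi x = 0%R].
Proof.
move=> cM; split=> /= [|x y cx cy|x cx]; first exact: additive_char1.
  by rewrite cM cx cy addr0.
by rewrite -[LHS]add0r -cx -cM mulgV additive_char1.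
Qed.

Section MaximalSubgroup.
Variables (M : set G) (x : G).
Hypotheses (maxM : is_maximal_subgroup M) (Mx : ~ M x).

Let sgM : is_subgroup M. Proof. by case: maxM. Qed.
Let MJ g z : M z -> M (z ^ g). Proof. by case: (hC.2 M maxM) => _; apply. Qed.

(** If p did not divide k, then k would be invertible modulo the order of x, a power of p, and x
    would be a power of x^k, hence in M. *)
Lemma maximal_subgroup_expgn k : M (x ^+ k) -> (p %| k)%N.
Proof.
move=> Mxk; apply/idPn => pk.
have [e [pe_gt0 xpe _]] := hG x.
have : coprime k (p ^ e) by rewrite coprime_sym coprimeXl // prime_coprime.
case: (posnP k) pk => [->|k_gt0 pk]; first by rewrite dvdn0.
case/(coprimeP _ k_gt0) => -[a b] /= kab.
have ab : (k * a = (p ^ e) * b + 1)%N.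
  by rewrite -kab addnC mulnC (mulnC _ b) subnK // ltnW // -subn_gt0 kab.
apply: Mx; have := subgroupX a sgM Mxk.
by rewrite -expgnA ab expgnDr expgnA xpe expg1n mul1g expg1.
Qed.

(** By normality M<x> is a subgroup, strictly larger than M, hence all of G. Natural exponents
    suffice because x has finite order. *)
Lemma mod_maximal_cyclic g : exists k, M (g * x ^+ k).
Proof.
pose H := [set g | exists k, M (g * x ^+ k)].
have [M1 MM MV] := sgM; have [_ _ maxM'] := maxM.
have [e [pe_gt0 xpe _]] := hG x.
have sgH : is_subgroup H.
  split; first by exists 0%N; rewrite mulg1.
    move=> a b [k Mak] [l Mbl]; exists (l + k)%N.
    have := MM _ _ Mak (MJ (x ^+ k) Mbl).
    by rewrite conjgE expgnDr !mulgA mulgK.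
  move=> a [k Mak]; exists (k * (p ^ e).-1)%N.
  have -> : x ^+ (k * (p ^ e).-1) = x ^- k.
    apply: (mulIg (x ^+ k)); rewrite mulVg -expgnDr -mulnSr prednK //.
    by rewrite mulnC expgnA xpe expg1n.
  by have := MJ (x ^- k) (MV _ Mak); rewrite invMg conjgE invgK !mulgA mulgV mul1g.
have [MH|HT] : H = M \/ H = setT.
- by apply: maxM' => // z Mz; exists 0%N; rewrite mulg1.
- case: Mx; rewrite -MH; exists (p ^ e).-1.
  by rewrite -expgS prednK // xpe.
- by have : H g by rewrite HT.
Qed.

Lemma maximal_subgroup_char :
  exists chi, [/\ additive_char chi, forall y, M y -> chi y = 0%R & chi x <> 0%R].
Proof.
have [M1 MM MV] := sgM.
have uniq g k l : M (g * x ^+ k) -> M (g * x ^+ l) -> (k%:R = l%:R :> 'F_p)%R.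
  wlog kl : k l / (k <= l)%N => [W Mk Ml|].
    by case/orP: (leq_total k l) => kl; [exact: W | symmetry; exact: W].
  rewrite -{1}(subnKC kl) expgnDr mulgA => Mk /(subgroupMl sgM Mk).
  move=> /maximal_subgroup_expgn; rewrite (dvdn_pcharf (pchar_Fp hp)).
  by rewrite natrB // subr_eq0 => /eqP.
(* The exponent f g puts g in the coset of x^(- f g), so f is minus the usual projection to G/M; by
   [uniq] it is well defined modulo p. *)
pose f g := sval (cid (mod_maximal_cyclic g)).
have fP g : M (g * x ^+ f g) by apply: svalP (cid (mod_maximal_cyclic g)).
exists (fun g => (f g)%:R%R : 'F_p); split=> [g h|g Mg|/eqP].
- rewrite -natrD; apply: (uniq (g * h)) => //.
  have := MM _ _ (fP g) (MJ (x ^+ f g) (fP h)).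
  by rewrite conjgE addnC expgnDr !mulgA mulgK.
- by apply: (uniq g _ 0%N) => //; rewrite mulg1.
- rewrite -(dvdn_pcharf (pchar_Fp hp)) => /dvdnP[q fq].
  have := fP x; rewrite -expgS fq => /maximal_subgroup_expgn.
  by rewrite -addn1 dvdn_addr ?dvdn_mull // dvdn1 => /eqP p1; move: hp; rewrite p1.
Qed.

End MaximalSubgroup.

Lemma generatingP s :
  generating s <->
  forall chi, additive_char chi -> {in s, forall x, chi x = 0%R} -> forall x, chi x = 0%R.
Proof.
split=> [gs chi chiM chis x|chis].
  have : seq_generated s x by rewrite gs.
  by apply: (seq_generated_sub (additive_char_subgroup chiM)) => y; apply: chis.
apply: contrapT => /(proper_sub_maximal hC.1 (seq_generated_subgroup s))[M maxM sM].
have [_ /eqP/setTPn[x Mx] _] := maxM.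
have [chi [chiM chiM0 chix]] := maximal_subgroup_char maxM Mx.
by apply: chix; apply: chis => // y /mem_seq_generated/sM/chiM0.
Qed.

(** * Dependence modulo the Frattini subgroup and Steinitz exchange *)

(* Equivalently, y lies in the subgroup generated by u and the Frattini subgroup. *)
Definition dependent y u : Prop :=
  forall chi, additive_char chi -> {in u, forall x, chi x = 0%R} -> chi y = 0%R.

Lemma generating_drop y u v : dependent y u -> generating (u ++ y :: v) -> generating (u ++ v).
Proof.
move=> yu /generatingP guyv; apply/generatingP => chi chiM chi0; apply: guyv => // x.
have chiu : {in u, forall z, chi z = 0%R} by move=> z zu; rewrite chi0 // mem_cat zu.
rewrite mem_cat inE => /or3P[xu|/eqP->|xv]; [exact: chiu|exact: yu|].
by rewrite chi0 // mem_cat xv orbT.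
Qed.

(** Append the entries of v to u one by one. Since u ++ v generates, y becomes dependent at some
    first x, and this x can be traded for y. *)
Lemma generating_exchange y u v : ~ dependent y u -> generating (u ++ v) ->
  exists v1 x v2, v = v1 ++ x :: v2 /\ generating (u ++ y :: v1 ++ v2).
Proof.
move=> yu guv.
suff step v1 w : ~ dependent y (u ++ v1) -> v = v1 ++ w ->
    exists v1 x v2, v = v1 ++ x :: v2 /\ generating (u ++ y :: v1 ++ v2).
  by apply: (step [::] v) => //; rewrite cats0.
elim: w v1 => [|x w IHw] v1 yuv1 vE.
  by case: yuv1; move: guv; rewrite vE cats0 => /generatingP guv chi chiM /guv; apply.
have [yx|] := pselect (dependent y (u ++ rcons v1 x)); last first.
  by move/IHw; apply; rewrite cat_rcons.
exists v1, x, w; split=> //; apply/generatingP => psi psiM psi0 z.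
have /generatingP guv' := guv; apply: guv' (psiM) _ z => z.
(* psi kills u, v1, w and y; if psi x <> 0, a multiple of psi subtracted from a *)
(* chi killing u and v1 makes it kill x as well without changing chi y. *)
have psi0' : forall z, z \in u ++ v1 ++ w -> psi z = 0%R.
  move=> t tin; apply: psi0; move: tin; rewrite !(mem_cat, inE).
  by case/or3P=> ->; rewrite ?orbT.
suff psix : psi x = 0%R.
  rewrite vE !(mem_cat, inE) => /or4P[zu|zv1|/eqP->|zw] //; apply: psi0'.
  - by rewrite !mem_cat zu.
  - by rewrite !mem_cat zv1 orbT.
  - by rewrite !mem_cat zw !orbT.
apply: contrapT => /eqP psix; apply: yuv1 => chi chiM chi0.
pose c := (chi x / psi x)%R.
have /yx : additive_char (fun g => chi g - c * psi g)%R.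
  by move=> a b; rewrite chiM psiM mulrDr opprD addrACA.
rewrite (psi0 y) ?mulr0 ?subr0; last by rewrite mem_cat inE eqxx orbT.
apply=> t; rewrite mem_cat mem_rcons inE => /or3P[tu|/eqP->|tv1].
- by rewrite chi0 ?psi0' ?mem_cat ?tu // mulr0 subr0.
- by rewrite /c divfK // subrr.
- by rewrite chi0 ?psi0' ?mem_cat ?tv1 ?orbT // mulr0 subr0.
Qed.

(** Steinitz: move the entries of s into v in turn. Each is either dependent on its predecessors,
    hence redundant, or displaces an entry of v; the shorter v runs out first. *)
Lemma generating_redundant s v : generating s -> generating v -> (size v < size s)%N ->
  exists s1 x s2, s = s1 ++ x :: s2 /\ generating (s1 ++ s2).
Proof.
move=> gs gv.
suff step u w v' : s = u ++ w -> generating (u ++ v') -> (size v' < size w)%N ->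
    exists s1 x s2, s = s1 ++ x :: s2 /\ generating (s1 ++ s2).
  exact: (step [::] s v).
elim: w u v' => // y w IHw u v' sE guv' vw.
have [yu|/generating_exchange/(_ guv')[v1 [x [v2 [v'E guyv]]]]] := pselect (dependent y u).
  by exists u, y, w; split=> //; apply: generating_drop yu _; rewrite -sE.
apply: (IHw (rcons u y) (v1 ++ v2)); rewrite ?cat_rcons //.
by move: vw; rewrite v'E !size_cat /= addnS ltnS.
Qed.

(** * Reduction of a generating tuple to a standard form *)

Lemma group_rankP :
  generated_by G (group_rank G) /\ forall m, generated_by G m -> (group_rank G <= m)%N.
Proof.
suff /xgetPex : exists r, [set r | generated_by G r /\
    forall m, generated_by G m -> (r <= m)%N] r by apply.
have exg : exists m, `[< generated_by G m >].
  by case: hC.1 => k gk; exists k; apply/asboolP.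
have [r /asboolP gr rmin] := ex_minnP exg.
by exists r; split=> // m /asboolP/rmin.
Qed.

Lemma minimal_independent u y w :
  generating (u ++ y :: w) -> size (u ++ y :: w) = group_rank G -> ~ dependent y u.
Proof.
move=> guyw szE yu; have guw := generating_drop yu guyw.
have : generated_by G (size (u ++ w)) by exists (in_tuple (u ++ w)).
by move/group_rankP.2; rewrite -szE !size_cat /= addnS ltnn.
Qed.

(** Each entry of v is redundant next to s; once turned into 1 it is absorbed into the generating
    prefix. *)
Lemma nielsen_equiv_ones s v :
  generating s -> nielsen_equiv (s ++ v) (s ++ nseq (size v) 1).
Proof.
elim: v s => [|x v IHv] s gs /=; first exact: nielsen_equiv_perm.
have gsub w z : {subset s <= w} -> generating w by move=> sw; apply: generating_sub gs.
have gsv : generating (s ++ v) by apply: generating_sub gs => z zs; rewrite mem_cat zs.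
have gs1 : generating (rcons s 1).
  by apply: generating_sub gs => z zs; rewrite mem_rcons inE zs orbT.
apply: nielsen_equiv_trans (_ : nielsen_equiv (x :: s ++ v) _).
  by apply: nielsen_equiv_perm; rewrite -(cat1s x v) perm_catCA.
apply: nielsen_equiv_trans (nielsen_equiv_replace_head x 1 gsv) _.
apply: nielsen_equiv_trans (_ : nielsen_equiv (s ++ 1 :: v) _).
  by apply: nielsen_equiv_perm; rewrite perm_sym -(cat1s 1 v) perm_catCA.
by rewrite -!cat_rcons; apply: IHv.
Qed.

Lemma nielsen_equiv_exchange z u v w :
  generating (u ++ v) -> generating (u ++ w) -> size (u ++ w) = group_rank G ->
  exists v', nielsen_equiv (z :: u ++ v) (1 :: u ++ w ++ v').
Proof.
elim: w z u v => [|y w IHw] z u v guv guw szE.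
  by exists v; apply: nielsen_equiv_replace_head.
have [v1 [x [v2 [vE guyv]]]] :=
  generating_exchange (minimal_independent guw szE) guv.
have [|||v' c] := IHw x (rcons u y) (v1 ++ v2); rewrite ?cat_rcons //.
exists v'; rewrite !cat_rcons in c.
apply: nielsen_equiv_trans (nielsen_equiv_replace_head z y guv) _.
apply: nielsen_equiv_trans c; apply: nielsen_equiv_perm.
apply/seq.permP => a; rewrite vE /= !count_cat /= !count_cat.
lia.
Qed.

Lemma nielsen_equiv_standard s t :
  generating s -> size s = group_rank G -> generating t -> (size s < size t)%N ->
  nielsen_equiv t (1 :: s ++ nseq (size t - (size s).+1) 1).
Proof.
move=> gs szE gt st; have [t1 [x [t2 [tE gt12]]]] := generating_redundant gt gs st.
have [v c] := @nielsen_equiv_exchange x [::] (t1 ++ t2) s gt12 gs szE.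
have {}c : nielsen_equiv t (1 :: s ++ v).
  apply: nielsen_equiv_trans c; apply: nielsen_equiv_perm.
  by rewrite tE -(cat1s x t2) perm_catCA.
(* Nielsen equivalence preserves length, which determines the size of v. *)
have -> : (size t - (size s).+1 = size v)%N.
  case: c => n [a] [b] [-> e _]; have := size_tuple b.
  by rewrite -e /= size_cat size_tuple => <-; rewrite subSS addKn.
apply: nielsen_equiv_trans c _.
apply: (@nielsen_equiv_ones (1 :: s)); apply: generating_sub gs => y ys.
by rewrite inE ys orbT.
Qed.

End Characters.

Theorem theorem1p6 (p : nat) (G : groupType) (hp : prime p)
    (hG : p_group p G) (hC : classC G) (n : nat)
    (hn : (group_rank G + 1 <= n)%N) :
  connected_graph (nielsen_graph G n).
Proof.
have [[s gs] _] := group_rankP hC.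
(* The right-hand side does not depend on t, so any two vertices meet there. *)
have std (t : n.-tuple G) : generating_tuple t ->
    nielsen_equiv t (1 :: s ++ nseq (n - (size s).+1) 1).
  move=> gt; have := nielsen_equiv_standard hp hG hC gs (size_tuple s) gt.
  by rewrite !size_tuple -addn1; apply.
move=> u v; apply/nielsen_conn_connected/nielsen_equiv_conn.
exact: nielsen_equiv_trans (std _ (svalP u)) (nielsen_equiv_sym (std _ (svalP v))).
Qed.
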